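(* Let $(M,g)$ be a pseudo-Riemannian manifold, let $\nabla$ be the Levi-Civita connection of $g$, let $J$ be a $g$-symmetric $(1,1)$-tensor field on $M$ and let $\tilde g(X,Y)=g(X,JY)$ be the twin metric defined by $g$ and $J$. If $J$ is invertible, then $(\tilde g,\nabla)$ defines a dualistic structure $(\tilde g;\nabla,\nabla^* )$, and the dual connection $\nabla^*$ is given by $$\nabla^*_XY=\nabla_XY+J^{-1}((\nabla_XJ)Y)$$ for all vector fields $X,Y$ on $M$.
   Context: $J$ is $g$-symmetric if $g(JX,Y)=g(X,JY)$ for all $X,Y$. For a non-degenerate $(0,2)$-tensor field $h$, two affine connections $\nabla,\nabla^*$ on $M$ are dual with respect to $h$, and $(h;\nabla,\nabla^* )$ is called a dualistic structure, if $X(h(Y,Z))=h(\nabla_XY,Z)+h(Y,\nabla^*_XZ)$ for all vector fields $X,Y,Z$. *)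

(* Defs.v *)
From HB Require Import structures.
From mathcomp Require Import all_boot all_order all_algebra.
From mathcomp Require Import all_classical all_reals all_analysis.

Set Implicit Arguments.
Unset Strict Implicit.
Unset Printing Implicit Defensive.

Import Order.TTheory GRing.Theory Num.Theory.
Import numFieldNormedType.Exports.

Local Open Scope classical_set_scope.
Local Open Scope ring_scope.

Section SmoothOn.
Context {R : realType} {n : nat}.
Implicit Types (U : set 'rV[R]_n) (f g : 'rV[R]_n -> R).

(* Meaningful for U open only: then the partial derivatives at the points of U,
   and hence the whole predicate, depend on the restriction of f to U alone. *)
Fixpoint Ck_on (k : nat) U f : Prop :=
  (forall x, U x -> {for x, continuous f}) /\
  if k is k'.+1 then
    forall i : 'I_n,
      (forall x, U x -> derivable f x (delta_mx 0 i)) /\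
      Ck_on k' U (fun x => 'D_(delta_mx 0 i) f x)
  else True.

Definition smooth_on U f : Prop := forall k, Ck_on k U f.

Lemma near_on U f g x : open U -> (forall y, U y -> f y = g y) -> U x ->
  \forall y \near x, f y = g y.
Proof.
move=> oU fg Ux; have : nbhs x U by apply: open_nbhs_nbhs.
by apply: filterS => y; exact: fg.
Qed.

Lemma continuous_on_ext U f g : open U -> (forall y, U y -> f y = g y) ->
  (forall x, U x -> {for x, continuous f}) ->
  forall x, U x -> {for x, continuous g}.
Proof.
move=> oU fg cf x Ux.
have e := near_eq_cvg (near_on oU fg Ux).
have h : g y @[y --> x] --> f x by exact: cvg_trans (e _) (cf x Ux).
by rewrite (fg x Ux) in h.
Qed.

Lemma Ck_on_ext k U f g : open U -> (forall x, U x -> f x = g x) ->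
  Ck_on k U f -> Ck_on k U g.
Proof.
move=> oU; elim: k f g => [|k IH] f g fg /= [cf df].
  by split=> //; exact: continuous_on_ext oU fg cf.
split; first exact: continuous_on_ext oU fg cf.
move=> i; have [dfi Dfi] := df i; split.
  move=> x Ux; apply: near_eq_derivable (dfi x Ux).
  exact: (near_on oU fg Ux).
apply: IH Dfi => x Ux; apply: near_eq_derive.
exact: (near_on oU fg Ux).
Qed.

Lemma Ck_onW k U f : Ck_on k.+1 U f -> Ck_on k U f.
Proof.
elim: k f => [|k IH] f [cf df]; first by split.
split=> // i; have [dfi Dfi] := df i; split=> //; exact: IH.
Qed.

Lemma Ck_on_cst k U (c : R) : Ck_on k U (fun=> c).
Proof.
elim: k c => [|k IH] c /=; split=> //; try by move=> x _; exact: cst_continuous.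
move=> i; split=> [x _|]; first exact: (@derivable_cst _ _ _ c x _).
suff -> : 'D_(delta_mx 0 i) (fun=> c) = (fun=> 0) :> ('rV[R]_n -> R) by [].
by apply/funext => x; rewrite (derive_cst c).
Qed.

Lemma Ck_onD k U f g : open U -> Ck_on k U f -> Ck_on k U g ->
  Ck_on k U (f + g).
Proof.
move=> oU; elim: k f g => [|k IH] f g /= [cf df] [cg dg].
  by split=> // x Ux; apply: continuousD; [exact: cf|exact: cg].
split; first by move=> x Ux; apply: continuousD; [exact: cf|exact: cg].
move=> i; have [dfi Dfi] := df i; have [dgi Dgi] := dg i; split.
  by move=> x Ux; apply: derivableD; [exact: dfi|exact: dgi].
apply: (Ck_on_ext oU _ (IH _ _ Dfi Dgi)) => x Ux.
by rewrite deriveD//; [exact: dfi|exact: dgi].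
Qed.

Lemma Ck_onM k U f g : open U -> Ck_on k U f -> Ck_on k U g ->
  Ck_on k U (f * g).
Proof.
move=> oU; elim: k f g => [|k IH] f g hf hg.
  case: hf hg => cf _ [cg _]; split=> // x Ux.
  by apply: continuousM; [exact: cf|exact: cg].
have [hf' hg'] := (Ck_onW hf, Ck_onW hg).
case: hf hg => cf df [cg dg]; split.
  by move=> x Ux; apply: continuousM; [exact: cf|exact: cg].
move=> i; have [dfi Dfi] := df i; have [dgi Dgi] := dg i; split.
  by move=> x Ux; apply: derivableM; [exact: dfi|exact: dgi].
apply: (Ck_on_ext oU _ (Ck_onD oU (IH _ _ hf' Dgi) (IH _ _ hg' Dfi))) => x Ux.
by rewrite deriveM//; [exact: dfi|exact: dgi].
Qed.

End SmoothOn.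

(* [chart_inv] is only relevant on the image of the chart, where it is the
   inverse homeomorphism. *)
Record chart (R : realType) (n : nat) (M : topologicalType) := Chart {
  chart_dom : set M;
  chart_map : M -> 'rV[R]_n;
  chart_inv : 'rV[R]_n -> M;
  chart_dom_open : open chart_dom;
  chart_img_open : open (chart_map @` chart_dom);
  chart_mapK : forall p, chart_dom p -> chart_inv (chart_map p) = p;
  chart_map_cont : {within chart_dom, continuous chart_map};
  chart_inv_cont : {within chart_map @` chart_dom, continuous chart_inv} }.

Record smoothManifold (R : realType) (n : nat) := SmoothManifold {
  mcarrier :> topologicalType;
  atlas : set (chart R n mcarrier);
  manifold_hausdorff : hausdorff_space mcarrier;
  manifold_second_countable : @second_countable mcarrier;
  atlas_cover : forall p : mcarrier, exists2 c, atlas c & chart_dom c p;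
  atlas_compat : forall c d, atlas c -> atlas d -> forall j : 'I_n,
    smooth_on (chart_map c @` (chart_dom c `&` chart_dom d))
      (fun x => chart_map d (chart_inv c x) 0 j) }.

Section SmoothFunctions.
Context {R : realType} {n : nat} (M : smoothManifold R n).

Definition smooth_fun (f : M -> R) : Prop := forall c, atlas c ->
  smooth_on (chart_map c @` chart_dom c) (f \o chart_inv c).

Definition smooth_pred : {pred M -> R} := fun f => `[< smooth_fun f >].

Lemma smooth_cst (a : R) : smooth_fun (fun=> a).
Proof. by move=> c Ac k; exact: Ck_on_cst. Qed.

Lemma smoothD f g : smooth_fun f -> smooth_fun g -> smooth_fun (f + g).
Proof.
move=> hf hg c Ac k; have oU := @chart_img_open _ _ _ c.
exact: (Ck_onD oU (hf c Ac k) (hg c Ac k)).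
Qed.

Lemma smoothM f g : smooth_fun f -> smooth_fun g -> smooth_fun (f * g).
Proof.
move=> hf hg c Ac k; have oU := @chart_img_open _ _ _ c.
exact: (Ck_onM oU (hf c Ac k) (hg c Ac k)).
Qed.

Lemma smooth_subring_closed : subring_closed smooth_pred.
Proof.
split.
- by apply/asboolP; exact: smooth_cst.
- move=> f g /asboolP hf /asboolP hg; apply/asboolP.
  apply: smoothD => //; rewrite -mulN1r.
  by apply: smoothM => //; exact: (smooth_cst (- 1)).
- by move=> f g /asboolP hf /asboolP hg; apply/asboolP; exact: smoothM.
Qed.

HB.instance Definition _ :=
  GRing.isSubringClosed.Build (M -> R) smooth_pred smooth_subring_closed.

Lemma smooth_scale_closed (a : R) (f : M -> R) :
  f \in smooth_pred -> a *: f \in smooth_pred.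
Proof.
move=> /asboolP hf; apply/asboolP.
exact: smoothM (smooth_cst a) hf.
Qed.

HB.instance Definition _ :=
  GRing.isScaleClosed.Build R (M -> R) smooth_pred smooth_scale_closed.

Record Cinf := MkCinf { Cinf_fun :> M -> R; CinfP : Cinf_fun \in smooth_pred }.

HB.instance Definition _ := [isSub for Cinf_fun].
HB.instance Definition _ := [Choice of Cinf by <:].
HB.instance Definition _ := 
  GRing.SubChoice_isSubComPzRing.Build _ _ Cinf (GRing.subringClosedP _).
HB.instance Definition _ := [SubZmodule_isSubLmodule of Cinf by <:].

End SmoothFunctions.

Section VectorFields.
Context {R : realType} {n : nat} (M : smoothManifold R n).
Local Notation C := (Cinf M).

(* Smooth vector fields as the R-linear derivations of C^oo(M). The tangent
   vector of X at p is the derivation f |-> X f p. *)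
Record vfield := VField {
  vf_fun :> C -> C;
  vf_linear : forall (a : R) (f g : C),
    vf_fun (a *: f + g) = a *: vf_fun f + vf_fun g;
  vf_leibniz : forall f g : C, vf_fun (f * g) = f * vf_fun g + g * vf_fun f }.

Lemma vfieldP (X Y : vfield) : (forall f, X f = Y f) <-> X = Y.
Proof.
split=> [|->//]; case: X Y => X lX dX [Y lY dY] /= /funext XY.
by subst Y; congr VField; exact: Prop_irrelevance.
Qed.

HB.instance Definition _ := gen_eqMixin vfield.
HB.instance Definition _ := gen_choiceMixin vfield.

Program Definition vf0 := @VField (fun=> 0) _ _.
Next Obligation. by move=> a f g /=; rewrite scaler0 addr0. Qed.
Next Obligation. by move=> f g /=; rewrite !mulr0 addr0. Qed.

Program Definition vf_opp (X : vfield) := @VField (fun f => - X f) _ _.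
Next Obligation. by move=> X a f g /=; rewrite vf_linear opprD scalerN. Qed.
Next Obligation. by move=> X f g /=; rewrite vf_leibniz opprD !mulrN. Qed.

Program Definition vf_add (X Y : vfield) := @VField (fun f => X f + Y f) _ _.
Next Obligation.
by move=> X Y a f g /=; rewrite !vf_linear scalerDr addrACA.
Qed.
Next Obligation.
by move=> X Y f g /=; rewrite !vf_leibniz !mulrDr addrACA.
Qed.

Program Definition vf_scale (h : C) (X : vfield) :=
  @VField (fun f => h * X f) _ _.
Next Obligation.
move=> h X a f g /=; rewrite vf_linear mulrDr; congr (_ + _).
by apply/val_inj/funext => p; rewrite /= /GRing.scale/= mulrCA.
Qed.
Next Obligation.
by move=> h X f g /=; rewrite vf_leibniz mulrDr !(mulrCA h).
Qed.

Lemma vf_addA : associative vf_add.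
Proof. by move=> X Y Z; apply/vfieldP => f /=; rewrite addrA. Qed.
Lemma vf_addC : commutative vf_add.
Proof. by move=> X Y; apply/vfieldP => f /=; rewrite addrC. Qed.
Lemma vf_add0 : left_id vf0 vf_add.
Proof. by move=> X; apply/vfieldP => f /=; rewrite add0r. Qed.
Lemma vf_addN : left_inverse vf0 vf_opp vf_add.
Proof. by move=> X; apply/vfieldP => f /=; rewrite addNr. Qed.

HB.instance Definition _ :=
  GRing.isZmodule.Build vfield vf_addA vf_addC vf_add0 vf_addN.

Lemma vf_scaleA a b X : vf_scale a (vf_scale b X) = vf_scale (a * b) X.
Proof. by apply/vfieldP => f /=; rewrite mulrA. Qed.
Lemma vf_scale1 : left_id 1 vf_scale.
Proof. by move=> X; apply/vfieldP => f /=; rewrite mul1r. Qed.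
Lemma vf_scaleDr : right_distributive vf_scale +%R.
Proof. by move=> a X Y; apply/vfieldP => f /=; rewrite mulrDr. Qed.
Lemma vf_scaleDl X : {morph vf_scale^~ X : a b / a + b}.
Proof. by move=> a b; apply/vfieldP => f /=; rewrite mulrDl. Qed.

HB.instance Definition _ := GRing.Zmodule_isLmodule.Build C vfield
  vf_scaleA vf_scale1 vf_scaleDr vf_scaleDl.

Program Definition lie_bracket (X Y : vfield) :=
  @VField (fun f => X (Y f) - Y (X f)) _ _.
Next Obligation.
by move=> X Y a f g /=; rewrite !vf_linear scalerBr opprD addrACA.
Qed.
Next Obligation.
move=> X Y f g /=.
have vfD (Z : vfield) u v : Z (u + v) = Z u + Z v.
  by have := vf_linear Z 1 u v; rewrite !scale1r.
have cancel_mixed (a b c d a' c' : C) :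
    a + b + (c + d) - (a' + d + (c' + b)) = a - a' + (c - c').
  rewrite (addrACA a') (addrC d) (addrACA a) opprD (addrACA (a + c)) subrr addr0.
  by rewrite opprD addrACA.
rewrite !vf_leibniz !vfD !vf_leibniz !mulrBr.
by rewrite (mulrC (X g)) (mulrC (X f)) cancel_mixed.
Qed.

End VectorFields.

Section Geometry.
Context {R : realType} {n : nat} {M : smoothManifold R n}.
Local Notation VF := (vfield M).
Local Notation C := (Cinf M).

(* Tensor fields are encoded as C^oo(M)-multilinear maps on vector fields. *)
Record tensor02 := Tensor02 {
  t02_fun :> VF -> VF -> C;
  t02_linearl : forall (a : C) (X Y Z : VF),
    t02_fun (a *: X + Y) Z = a * t02_fun X Z + t02_fun Y Z;
  t02_linearr : forall (a : C) (X Y Z : VF),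
    t02_fun Z (a *: X + Y) = a * t02_fun Z X + t02_fun Z Y }.

Definition tensor11 := {linear VF -> VF}.

Definition vanishes_at (p : M) (X : VF) : Prop := forall f : C, X f p = 0.

(* Non-degeneracy of the bilinear form h_p on T_pM at every point p; as every
   tangent vector extends to a global vector field, it can be tested on these. *)
Definition nondegenerate (h : tensor02) : Prop := forall p : M,
  (forall X : VF, (forall Y : VF, h X Y p = 0) -> vanishes_at p X) /\
  (forall Y : VF, (forall X : VF, h X Y p = 0) -> vanishes_at p Y).

Definition symmetric_tensor (h : tensor02) : Prop := forall X Y : VF, h X Y = h Y X.

Definition pseudo_riemannian_metric (g : tensor02) : Prop :=
  symmetric_tensor g /\ nondegenerate g.

Record connection := Connection {
  conn_fun :> VF -> VF -> VF;
  conn_linearl : forall (a : C) (X Y Z : VF),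
    conn_fun (a *: X + Y) Z = a *: conn_fun X Z + conn_fun Y Z;
  conn_addr : forall X Y Z : VF,
    conn_fun X (Y + Z) = conn_fun X Y + conn_fun X Z;
  conn_leibniz : forall (X : VF) (f : C) (Y : VF),
    conn_fun X (f *: Y) = X f *: Y + f *: conn_fun X Y }.

Definition torsion_free (nabla : connection) : Prop :=
  forall X Y : VF, nabla X Y - nabla Y X = lie_bracket X Y.

Definition metric_connection (g : tensor02) (nabla : connection) : Prop :=
  forall X Y Z : VF, X (g Y Z) = g (nabla X Y) Z + g Y (nabla X Z).

Definition levi_civita (g : tensor02) (nabla : connection) : Prop :=
  torsion_free nabla /\ metric_connection g nabla.

(* [covd nabla J X Y] is (nabla_X J) Y. *)
Definition covd (nabla : connection) (J : tensor11) (X Y : VF) : VF :=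
  nabla X (J Y) - J (nabla X Y).

Definition g_symmetric (g : tensor02) (J : tensor11) : Prop :=
  forall X Y : VF, g (J X) Y = g X (J Y).

Program Definition twin_metric (g : tensor02) (J : tensor11) : tensor02 :=
  @Tensor02 (fun X Y => g X (J Y)) _ _.
Next Obligation. by move=> g J a X Y Z /=; rewrite t02_linearl. Qed.
Next Obligation. by move=> g J a X Y Z /=; rewrite linearP t02_linearr. Qed.

Definition dual_connections (h : tensor02) (nabla nablas : connection) : Prop :=
  forall X Y Z : VF, X (h Y Z) = h (nabla X Y) Z + h Y (nablas X Z).

Definition dualistic_structure (h : tensor02) (nabla nablas : connection) :
  Prop := nondegenerate h /\ dual_connections h nabla nablas.

End Geometry.

Arguments tensor02 {R n} M.
Arguments tensor11 {R n} M.
Arguments connection {R n} M.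

(* Main.v *)
Require Import Defs.
From HB Require Import structures.
From mathcomp Require Import all_boot all_order all_algebra.
From mathcomp Require Import all_classical all_reals all_analysis.

Import GRing.Theory.
Local Open Scope ring_scope.

(** The dual connection is the conjugate of the Levi-Civita connection by J:
    J^-1 (nabla_X (J Y)) = nabla_X Y + J^-1 ((nabla_X J) Y). With it, duality
    for the twin metric is metric compatibility of nabla applied to the pair
    (Y, J Z), and uniqueness follows from non-degeneracy of the twin metric. *)

Section DualConnection.
Local Set Implicit Arguments.
Local Unset Strict Implicit.
Context {R : realType} {n : nat} {M : smoothManifold R n}.
Implicit Types (g h : tensor02 M) (J : tensor11 M) (nabla : connection M).

Lemma vanishes_everywhere (X : vfield M) : (forall p, vanishes_at p X) -> X = 0.
Proof.
by move=> X0; apply/vfieldP => f; apply/val_inj/funext => p; exact: X0.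
Qed.

Lemma tensor02Br h (X Y Z : vfield M) : h Z (X - Y) = h Z X - h Z Y.
Proof.
by rewrite addrC -scaleN1r t02_linearr mulN1r addrC.
Qed.

(** Non-degeneracy is pointwise: applied to [Y - Z] at each [p] it makes this field vanish there,
    and a derivation vanishing at every point is zero. *)
Lemma nondegenerate_injr h (Y Z : vfield M) :
  Defs.nondegenerate h -> (forall X, h X Y = h X Z) -> Y = Z.
Proof.
move=> ndh hYZ; apply/subr0_eq/vanishes_everywhere => p.
by apply: (ndh p).2 => X; rewrite tensor02Br hYZ subrr.
Qed.

Lemma dual_connection_unique h nabla (nabla1 nabla2 : connection M) :
  dualistic_structure h nabla nabla1 -> dualistic_structure h nabla nabla2 ->
  forall X Y : vfield M, nabla1 X Y = nabla2 X Y.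
Proof.
move=> [ndh d1] [_ d2] X Z; apply: nondegenerate_injr ndh _ => Y.
(* Adding [h (nabla X Y) Z] to either side gives [X (h Y Z)]. *)
by apply: (addrI (h (nabla X Y) Z)); rewrite -d1 -d2.
Qed.

(* Symmetry of J moves it to the first argument of g, so that in both arguments
   only surjectivity of J on vector fields is needed, not its injectivity on
   tangent spaces. *)
Lemma twin_metric_nondegenerate g J (Jinv : vfield M -> vfield M) :
  Defs.nondegenerate g -> g_symmetric g J -> cancel Jinv J ->
  Defs.nondegenerate (twin_metric g J).
Proof.
move=> ndg hJ JinvK p; split=> [X X0|Y Y0].
  by apply: (ndg p).1 => Y; rewrite -(JinvK Y); exact: X0.
by apply: (ndg p).2 => X; rewrite -(JinvK X) hJ; exact: Y0.
Qed.

Section Conjugate.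
Variables (nabla : connection M) (J : tensor11 M) (Jinv : vfield M -> vfield M).
Hypotheses (JK : cancel J Jinv) (JinvK : cancel Jinv J).

Let conj_conn_fun (X Y : vfield M) : vfield M := Jinv (nabla X (J Y)).

(** [Jinv] is given as a bare function, so each connection axiom is checked after applying [J],
    which is linear and injective. *)
Let conj_conn_linearl (a : Cinf M) (X Y Z : vfield M) :
  conj_conn_fun (a *: X + Y) Z = a *: conj_conn_fun X Z + conj_conn_fun Y Z.
Proof.
by apply: (can_inj JK); rewrite linearP !JinvK conn_linearl.
Qed.

Let conj_conn_addr (X Y Z : vfield M) :
  conj_conn_fun X (Y + Z) = conj_conn_fun X Y + conj_conn_fun X Z.
Proof.
by apply: (can_inj JK); rewrite linearD !JinvK linearD conn_addr.
Qed.

Let conj_conn_leibniz (X : vfield M) (f : Cinf M) (Y : vfield M) :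
  conj_conn_fun X (f *: Y) = X f *: Y + f *: conj_conn_fun X Y.
Proof.
(* Linearity of [J] over smooth functions turns this into the Leibniz rule of [nabla] for
   [f *: J Y]. *)
by apply: (can_inj JK); rewrite linearD !linearZ !JinvK !linearZ conn_leibniz.
Qed.

Definition conj_conn : connection M :=
  Connection conj_conn_linearl conj_conn_addr conj_conn_leibniz.

Lemma conj_connE (X Y : vfield M) :
  conj_conn X Y = nabla X Y + Jinv (covd nabla J X Y).
Proof.
(* Under [J] the right side telescopes to [nabla X (J Y)]. *)
by apply: (can_inj JK); rewrite linearD !JinvK /covd addrC subrK.
Qed.

Lemma conj_conn_dual g :
  metric_connection g nabla -> dual_connections (twin_metric g J) nabla conj_conn.
Proof. by move=> mg X Y Z; rewrite /= JinvK mg. Qed.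

End Conjugate.

End DualConnection.

Theorem proposition5p4 (R : realType) (n : nat) (M : smoothManifold R n)
    (g : tensor02 M) (hg : pseudo_riemannian_metric g)
    (nabla : connection M) (hnabla : levi_civita g nabla)
    (J : tensor11 M) (hJ : g_symmetric g J)
    (Jinv : vfield M -> vfield M) (JK : cancel J Jinv) (JinvK : cancel Jinv J) :
  exists nablas : connection M,
    [/\ dualistic_structure (twin_metric g J) nabla nablas,
        forall nablas' : connection M,
          dualistic_structure (twin_metric g J) nabla nablas' ->
          forall X Y : vfield M, nablas' X Y = nablas X Y
      & forall X Y : vfield M,
          nablas X Y = nabla X Y + Jinv (covd nabla J X Y)].
Proof.
have dual : dualistic_structure (twin_metric g J) nabla
    (conj_conn nabla JK JinvK).
  split; first exact: twin_metric_nondegenerate hg.2 hJ JinvK.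
  exact: conj_conn_dual hnabla.2.
exists (conj_conn nabla JK JinvK); split=> // [nablas' dual'|X Y].
  exact: dual_connection_unique dual' dual.
exact: conj_connE.
Qed.
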